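(* Let $1\le m\le n$ be integers. The clique partition number of the Johnson graph $J_n(m,m-1)$ is $$cp(J_n(m,m-1)) = \begin{cases}\dbinom{n}{m+1} & \text{if } n<2m,\\[2mm] \dbinom{n}{m-1} & \text{if } n\ge 2m.\end{cases}$$
   Context: $[n]=\{1,2,\ldots,n\}$ and $\binom{[n]}{m}$ is the collection of all $m$-element subsets of $[n]$. The Johnson graph $J_n(m,m-1)$ is the simple undirected graph with $\binom{n}{m}$ nodes, each node $v$ labelled by a unique set $\nu(v)\in\binom{[n]}{m}$ (so $\nu$ is a bijection from nodes to $\binom{[n]}{m}$), in which distinct nodes $v_i,v_j$ are adjacent if and only if $|\nu(v_i)\cap\nu(v_j)| = m-1$. The clique partition number $cp(G)$ is the minimum number of cliques (complete subgraphs) of $G$ needed to partition the edges of $G$, i.e. such that every edge of $G$ lies in exactly one of the chosen cliques (it is $0$ if $G$ has no edges). Convention: $\binom{n}{k}=0$ for $k>n$. *)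

(* Defs.v *)
From mathcomp Require Import all_boot.

Set Implicit Arguments.
Unset Strict Implicit.
Unset Printing Implicit Defensive.

Record sgraph := SGraph {
  node :> finType;
  adj : rel node;
  adj_sym : symmetric adj;
  adj_irrefl : irreflexive adj
}.

Section CliquePartition.

Variable G : sgraph.
Implicit Types (K : {set G}) (P : {set {set G}}).

Definition clique K : bool :=
  [forall x in K, forall y in K, (x != y) ==> adj x y].

(* Cliques with at most one node cover no edge; allowing them in P does not
   change the minimum cardinality. *)
Definition clique_partition P : bool :=
  [forall K in P, clique K] &&
  [forall x : G, forall y : G,
     adj x y ==> (#|[set K in P | (x \in K) && (y \in K)]| == 1)].

Lemma clique_partition_ex :
  exists k, [exists P, clique_partition P && (#|P| == k)].
Proof.
pose P := [set [set p.1; p.2] | p in [pred p : G * G | adj p.1 p.2]].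
exists #|P|; apply/existsP; exists P; rewrite eqxx andbT.
apply/andP; split.
  apply/forallP => K; apply/implyP => /imsetP[[a b] /= ab ->].
  have ab' : adj a b by [].
  apply/forallP => x; apply/implyP; rewrite !inE => xE.
  apply/forallP => y; apply/implyP; rewrite !inE => yE; apply/implyP.
  by case/orP: xE => /eqP->; case/orP: yE => /eqP->; rewrite ?eqxx // adj_sym.
apply/forallP => x; apply/forallP => y; apply/implyP => xy.
apply/cards1P; exists [set x; y]; apply/setP => K; rewrite !inE.
apply/idP/eqP => [|->]; last first.
  by rewrite !inE !eqxx orbT !andbT; apply/imsetP; exists (x, y).
case/andP => /imsetP[[a b] /= _ ->]; rewrite !inE => /andP[xE yE].
have nxy : x != y by apply: contraTneq xy => ->; rewrite adj_irrefl.
case/orP: xE yE nxy => /eqP->; case/orP => /eqP->; rewrite ?eqxx // => _.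
by rewrite setUC.
Qed.

Definition cp : nat := ex_minn clique_partition_ex.

End CliquePartition.

Section Johnson.

Variables n m : nat.

Definition johnson_node := {v : {set 'I_n} | #|v| == m}.

(* The labelling of nodes by m-subsets is val. *)
Definition johnson_adj : rel johnson_node :=
  fun v w => (v != w) && (#|val v :&: val w| == m - 1).

Lemma johnson_adj_sym : symmetric johnson_adj.
Proof. by move=> v w; rewrite /johnson_adj eq_sym setIC. Qed.

Lemma johnson_adj_irrefl : irreflexive johnson_adj.
Proof. by move=> v; rewrite /johnson_adj eqxx. Qed.

Definition johnson : sgraph := SGraph johnson_adj_sym johnson_adj_irrefl.

End Johnson.

(* Main.v *)
Require Import Defs.
From mathcomp Require Import all_boot.
From mathcomp Require Import all_order all_algebra zify lra.

Set Implicit Arguments.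
Unset Strict Implicit.
Unset Printing Implicit Defensive.

Import Order.TTheory GRing.Theory Num.Theory.

(** Every edge vw of the Johnson graph determines the (m-1)-set common to v and
    w, so the stars of the (m-1)-sets, consisting of the nodes above a given
    (m-1)-set, partition the edges into 'C(n, m - 1) cliques.  When 2m <= n this
    is optimal, by a rank argument in the spirit of Fisher's inequality.

    Let A be the adjacency matrix of a graph, and N the node-block incidence
    matrix of a partition of its edges into cliques.  Then N N^T = A + D, where
    the diagonal matrix D counts the blocks through each node
    (sum_sqr_decomposition).  In the Johnson graph a node has m pairwise
    nonadjacent neighbours, namely m disjoint exchanges of an element of the set
    with an outside element (johnson_independent_neighbors).  The blocks
    carrying the edges to them are distinct, so D >= m for every clique
    partition (block_degree_ge), with equality for the stars, whose incidence
    matrix M thus satisfies M M^T = A + m <= N N^T.  Hence the left kernel of N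
    lies in that of M, the rank of M is at most that of N, and so at most the
    number of blocks (leq_card_ker).  This is cp_regular_decomposition, stated
    for any graph with a clique partition like the stars.

    It remains to see that the columns of M are independent, that is, that the
    inclusion matrix between k-sets and (k+1)-sets, k = m - 1, has full rank
    when 2k < n (inclusion_inj).  Both the stars of (k-1)-sets and those of
    (k+1)-sets decompose the Johnson graph on k-sets, with block degrees k and
    n - k.  Their quadratic forms thus differ by n - 2k > 0 times the identity,
    and the form of the (k+1)-sets is positive definite.

    The range n < 2m follows by taking complements, which identifies the Johnson
    graphs on m-sets and (n-m)-sets (cp_johnson_le_compl). *)

(** * Clique partitions as indexed families *)

Section Decomposition.

Variables (G : sgraph).

(** One equation encodes both conditions on a clique partition: where adj u v
    holds it is the partition of the edges, elsewhere it makes the blocks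
    cliques.  Indexing the blocks by a finite type spares all questions about
    whether distinct indices give distinct blocks. *)
Definition clique_decomposition (I : finType) (K : I -> {set G}) :=
  forall u v : G, u != v ->
    #|[set i | (u \in K i) && (v \in K i)]| = @adj G u v.

Definition block_degree (I : finType) (K : I -> {set G}) (v : G) :=
  #|[set i | v \in K i]|.

Lemma cp_le_decomposition (I : finType) (K : I -> {set G}) :
  clique_decomposition K -> cp G <= #|I|.
Proof.
move=> decK; rewrite /cp; case: ex_minnP => k _ min_k.
apply: (@leq_trans #|[set K i | i in I]|); last exact: leq_imset_card.
apply/min_k/existsP; exists [set K i | i in I]; rewrite eqxx andbT.
apply/andP; split.
  apply/forall_inP => _ /imsetP[i _ ->].
  apply/forall_inP => u ui; apply/forall_inP => v vi; apply/implyP => uv.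
  have : 0 < #|[set i | (u \in K i) && (v \in K i)]|.
    by apply/card_gt0P; exists i; rewrite inE ui vi.
  by rewrite decK //; case: (adj u v).
apply/forallP => u; apply/forallP => v; apply/implyP => uv.
have u_neq_v : u != v by apply: contraTneq uv => ->; rewrite adj_irrefl.
have /eqP := decK u v u_neq_v; rewrite uv => /cards1P[i defi].
have ini j : (u \in K j) && (v \in K j) = (j == i).
  by have /setP/(_ j) := defi; rewrite !inE.
apply/cards1P; exists (K i); apply/setP => C; rewrite !inE.
apply/andP/eqP => [[/imsetP[j _ ->]]|->]; first by rewrite ini => /eqP->.
by rewrite ini eqxx imset_f.
Qed.

Lemma cp_decomposition :
  exists (I : finType) (K : I -> {set G}), clique_decomposition K /\ #|I| = cp G.
Proof.
rewrite /cp; case: ex_minnP => k /existsP[P /andP[/andP[clP edP] /eqP<-]] _.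
exists {C : {set G} | C \in P}, val; split; last by rewrite card_sig cardE -cardE.
move=> u v uv.
have -> : #|[set i : {C : {set G} | C \in P} | (u \in val i) && (v \in val i)]|
        = #|[set C in P | (u \in C) && (v \in C)]|.
  rewrite -(card_imset _ val_inj); apply: eq_card => C; rewrite inE.
  apply/imsetP/andP => [[D]|[CP uvC]].
    by rewrite inE => uvD ->; split=> //; exact: (valP D).
  by exists (exist _ C CP); rewrite ?inE.
case: (boolP (adj u v)) => [a_uv|na_uv].
  by move/forallP/(_ u)/forallP/(_ v)/implyP/(_ a_uv)/eqP: edP.
apply/eqP; rewrite cards_eq0; apply: contraNT na_uv => /set0Pn[C].
rewrite inE => /andP[CP /andP[uC vC]].
move/forall_inP/(_ _ CP)/forall_inP/(_ _ uC)/forall_inP/(_ _ vC): clP.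
by move/implyP; apply.
Qed.

(** A block through x contains at most one node of an independent set of
    neighbours of x, and each of these d edges at x needs a block. *)
Lemma block_degree_ge (I : finType) (K : I -> {set G}) (d : nat) (x : G)
    (s : 'I_d -> G) :
  clique_decomposition K -> (forall i, @adj G x (s i)) ->
  (forall i j, i != j -> s i != s j /\ ~~ @adj G (s i) (s j)) ->
  d <= block_degree K x.
Proof.
move=> decK xs stable.
have exK i : exists k, (x \in K k) && (s i \in K k).
  have xi : x != s i by apply: contraTneq (xs i) => <-; rewrite adj_irrefl.
  have /eqP := decK x (s i) xi; rewrite xs => /cards1P[k /setP/(_ k)].
  by rewrite !inE eqxx => ?; exists k.
pose f i := xchoose (exK i).
have fP i : (x \in K (f i)) && (s i \in K (f i)) := xchooseP (exK i).
have inj_f : injective f.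
  move=> i j fij; apply/eqP/negPn/negP => /stable[sij /negbTE nadj].
  have := decK _ _ sij; rewrite nadj => /eqP; rewrite cards_eq0.
  move=> /eqP/setP/(_ (f i)).
  by rewrite !inE {2}fij; case/andP: (fP i) => _ ->; case/andP: (fP j) => _ ->.
rewrite -[d]card_ord -(card_imset _ inj_f); apply/subset_leq_card/subsetP.
by move=> _ /imsetP[i _ ->]; rewrite inE; case/andP: (fP i).
Qed.

End Decomposition.

(** A clique partition of H restricts to any induced subgraph. *)
Lemma cp_induced (G H : sgraph) (f : G -> H) :
  injective f -> (forall u v, @adj H (f u) (f v) = @adj G u v) -> cp G <= cp H.
Proof.
move=> inj_f adjf; have [I [K [decK <-]]] := cp_decomposition H.
apply: (@cp_le_decomposition _ _ (fun i => f @^-1: K i)) => u v uv.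
rewrite -adjf -decK ?(inj_eq inj_f) //.
by apply: eq_card => i; rewrite !inE.
Qed.

(** * The quadratic form of a clique decomposition *)

Local Open Scope ring_scope.

(** This is the identity N N^T = A + D evaluated at x: the coefficient of
    x u * x v in the sum of squares counts the blocks containing u and v. *)
Lemma sum_sqr_decomposition (G : sgraph) (I : finType) (K : I -> {set G})
    (x : G -> rat) :
  clique_decomposition K ->
  \sum_i (\sum_(v in K i) x v) ^+ 2 =
    \sum_v (block_degree K v)%:R * x v ^+ 2 +
    \sum_u \sum_(v | adj u v) x u * x v.
Proof.
move=> decK.
transitivity (\sum_u \sum_v
    #|[set i | (u \in K i) && (v \in K i)]|%:R * (x u * x v)).
  transitivity (\sum_i \sum_u \sum_v
      ((u \in K i) && (v \in K i))%:R * (x u * x v)).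
    apply: eq_bigr => i _; rewrite expr2 mulr_suml big_mkcond /=.
    apply: eq_bigr => u _; case: (u \in K i) => /=; last first.
      by rewrite big1 // => v _; rewrite mul0r.
    rewrite mulr_sumr big_mkcond /=; apply: eq_bigr => v _.
    by case: (v \in K i); rewrite ?mul1r ?mul0r.
  rewrite exchange_big /=; apply: eq_bigr => u _.
  rewrite exchange_big /=; apply: eq_bigr => v _.
  rewrite -mulr_suml -natr_sum; congr (_%:R * _).
  rewrite -sum1_card [RHS]big_mkcond /=.
  by apply: eq_bigr => i _; rewrite inE; case: ifP.
rewrite -big_split /=; apply: eq_bigr => u _.
rewrite (bigD1 u) //= expr2; congr (_ + _).
  by congr (_%:R * _); apply: eq_card => i; rewrite !inE andbb.
rewrite [LHS]big_mkcond [RHS]big_mkcond /=; apply: eq_bigr => v _.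
rewrite eq_sym; case: eqVneq => [<-|uv] /=; first by rewrite adj_irrefl.
by rewrite decK //; case: (adj u v); rewrite ?mul1r ?mul0r.
Qed.

(** Read through incidence matrices (nodes as rows): the left kernel of A is
    contained in that of B, and the columns of B are independent, so that
    #|J| = rank B <= rank A <= #|I|. *)
Lemma leq_card_ker (V I J : finType) (A : I -> {set V}) (B : J -> {set V}) :
  (forall x : V -> rat, (forall i, \sum_(v in A i) x v = 0) ->
     forall j, \sum_(v in B j) x v = 0) ->
  (forall y : J -> rat, (forall v, \sum_(j | v \in B j) y j = 0) ->
     forall j, y j = 0) ->
  (#|J| <= #|I|)%N.
Proof.
move=> kerAB injB.
pose inc (T : finType) (C : T -> {set V}) : 'M[rat]_(#|V|, #|T|) :=
  \matrix_(v, i) (enum_val v \in C (enum_val i))%:R.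
have incE (T : finType) (C : T -> {set V}) (x : 'rV[rat]_#|V|) (t : T) :
    (x *m inc T C) 0 (enum_rank t) = \sum_(v in C t) x 0 (enum_rank v).
  rewrite mxE [RHS]big_mkcond [LHS](reindex _ (onW_bij _ (enum_rank_bij V))) /=.
  apply: eq_bigr => v _; rewrite mxE !enum_rankK.
  by case: ifP; rewrite ?mulr1 ?mulr0.
have rankB : \rank (inc J B) = #|J|.
  rewrite -mxrank_tr; apply/eqP/inj_row_free => y yB0.
  apply/rowP => j; rewrite mxE -(enum_valK j).
  apply: (injB (fun j => y 0 (enum_rank j))) => v.
  have /rowP/(_ (enum_rank v)) := yB0; rewrite !mxE => yBv0; rewrite -[RHS]yBv0.
  rewrite big_mkcond [RHS](reindex _ (onW_bij _ (enum_rank_bij J))) /=.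
  apply: eq_bigr => i _; rewrite !mxE !enum_rankK.
  by case: ifP; rewrite ?mulr1 ?mulr0.
have ker_sub : (kermx (inc I A) <= kermx (inc J B))%MS.
  apply/rV_subP => x /sub_kermxP xA; apply/sub_kermxP/rowP => j.
  rewrite -(enum_valK j) incE mxE.
  by apply: kerAB => i; rewrite -incE xA mxE.
have := mxrankS ker_sub; rewrite !mxrank_ker rankB => le_ker.
have le_I := rank_leq_col (inc I A); have le_V := rank_leq_row (inc J B).
by rewrite rankB in le_V; lia.
Qed.

(** If x is orthogonal to all blocks of some clique partition, its quadratic
    form vanishes there; passing to L replaces the block degrees by the
    smallest possible value d, hence can only lower the form, which is still
    a sum of squares.  So x is orthogonal to all blocks of L, and the ranks
    compare. *)
Theorem cp_regular_decomposition (G : sgraph) (J : finType) (L : J -> {set G})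
    (d : nat) :
  clique_decomposition L ->
  (forall v, block_degree L v = d) ->
  (forall v, exists s : 'I_d -> G, (forall i, @adj G v (s i)) /\
     forall i j, i != j -> s i != s j /\ ~~ @adj G (s i) (s j)) ->
  (forall y : J -> rat, (forall v, \sum_(j | v \in L j) y j = 0) ->
     forall j, y j = 0) ->
  cp G = #|J|.
Proof.
move=> decL degL star freeL.
apply/eqP; rewrite eqn_leq (cp_le_decomposition decL) /=.
have [I [K [decK <-]]] := cp_decomposition G.
apply: (@leq_card_ker _ _ _ K L) => // x Kx0.
have sumL0 : \sum_j (\sum_(v in L j) x v) ^+ 2 <= 0.
  have sumK0 : \sum_i (\sum_(v in K i) x v) ^+ 2 = 0.
    by rewrite big1 // => i _; rewrite Kx0 expr0n.
  rewrite -[leRHS]sumK0 !sum_sqr_decomposition // lerD2r; apply: ler_sum => v _.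
  rewrite ler_wpM2r ?sqr_ge0 // ler_nat degL.
  by have [s [vs stable]] := star v; apply: block_degree_ge vs stable.
have sumL_eq0 : \sum_j (\sum_(v in L j) x v) ^+ 2 = 0.
  by apply/eqP; rewrite eq_le sumL0 sumr_ge0 // => j _; exact: sqr_ge0.
move=> j; apply/eqP; rewrite -sqrf_eq0; apply/eqP.
by apply: (psumr_eq0P _ sumL_eq0) => // i _; exact: sqr_ge0.
Qed.

(** * The two clique decompositions of a Johnson graph *)

Local Open Scope nat_scope.

Section Johnson.

Variable n : nat.
Implicit Types (m k : nat).

(** The nodes above a set C of size m - 1.  Writing the size condition as
    #|C|.+1 == m leaves no index when m = 0, which makes every node lie in
    exactly m lower stars for all m. *)
Definition lower_star m (C : {C : {set 'I_n} | #|C|.+1 == m}) : {set johnson n m} :=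
  [set v : johnson n m | val C \subset val v].

Definition upper_star m (A : {A : {set 'I_n} | #|A| == m.+1}) : {set johnson n m} :=
  [set v : johnson n m | val v \subset val A].

(** The match on m gives the correct count 0 for m = 0, where a binomial
    coefficient with truncated m - 1 would give 1. *)
Lemma card_corank1 (S : {set 'I_n}) m :
  #|[set C : {set 'I_n} | (C \subset S) && (#|C|.+1 == m)]| =
    if m is k.+1 then 'C(#|S|, k) else 0.
Proof.
case: m => [|k]; last by rewrite -cards_draws; apply: eq_card => C; rewrite !inE eqSS.
by apply/eqP; rewrite cards_eq0; apply/eqP/setP => C; rewrite !inE andbF.
Qed.

Lemma card_sub_sig (p q : pred {set 'I_n}) :
  #|[set C : {C | q C} | p (val C)]| = #|[set C | p C && q C]|.
Proof.
rewrite -(card_imset _ val_inj); apply: eq_card => C; rewrite inE.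
apply/imsetP/andP => [[D]|[pC qC]].
  by rewrite inE => pD ->; split=> //; exact: (valP D).
by exists (exist _ C qC); rewrite ?inE.
Qed.

Lemma lower_star_meet m (u v : johnson n m) :
  #|[set C | (u \in lower_star C) && (v \in lower_star C)]| =
    if m is k.+1 then 'C(#|val u :&: val v|, k) else 0.
Proof.
rewrite -card_corank1 -card_sub_sig.
by apply: eq_card => C; rewrite !inE subsetI.
Qed.

(** Complementation turns the sets of size m + 1 above u and v into the sets of
    size n - m - 1 below the complement of their union. *)
Lemma upper_star_meet m (u v : johnson n m) :
  #|[set A | (u \in upper_star A) && (v \in upper_star A)]| =
    if n - m is k.+1 then 'C(#|~: (val u :|: val v)|, k) else 0.
Proof.
rewrite -card_corank1.
transitivity #|[set A : {set 'I_n} | (val u :|: val v \subset A) && (#|A| == m.+1)]|.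
  by rewrite -card_sub_sig; apply: eq_card => A; rewrite !inE subUset.
rewrite -(card_imset _ (inv_inj (@setCK 'I_n))); apply: eq_card => A.
rewrite inE -[A in LHS]setCK (mem_imset _ _ (inv_inj (@setCK 'I_n))) inE.
rewrite -[in RHS]setCS setCK; congr andb.
have := cardsC A; have := max_card (mem (val u)).
rewrite (eqP (valP u)) card_ord => *; apply/eqP/eqP; lia.
Qed.

Lemma johnson_card_meet m (u v : johnson n m) : u != v ->
  #|val u :&: val v| < m.
Proof.
move=> uv; rewrite -[X in _ < X](eqP (valP u)); apply: proper_card.
rewrite properEneq subsetIl andbT; apply: contra uv => /eqP/setIidPl uv.
apply/eqP/val_inj/eqP; rewrite eqEcard uv.
by rewrite (eqP (valP u)) (eqP (valP v)) leqnn.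
Qed.

Lemma johnson_card_join m (u v : johnson n m) :
  #|val u :|: val v| + #|val u :&: val v| = m + m.
Proof. by rewrite cardsUI (eqP (valP u)) (eqP (valP v)). Qed.

Lemma johnson_adjE m (u v : johnson n m) : u != v ->
  @adj (johnson n m) u v = (#|val u :&: val v| == m - 1).
Proof. by rewrite /= /johnson_adj => ->. Qed.

Lemma lower_star_decomposition m : clique_decomposition (@lower_star m).
Proof.
move=> u v uv; rewrite lower_star_meet johnson_adjE //.
have := johnson_card_meet uv; case: m u v uv => // k u v _.
rewrite ltnS subn1 /= leq_eqVlt => /predU1P[->|lt_k]; first by rewrite binn eqxx.
by rewrite bin_small // ltn_eqF.
Qed.

Lemma upper_star_decomposition m : clique_decomposition (@upper_star m).
Proof.
move=> u v uv; rewrite upper_star_meet johnson_adjE //.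
have := johnson_card_meet uv; have := johnson_card_join u v.
have := cardsC (val u :|: val v); rewrite card_ord.
set J := #|_ :|: _|; set M := #|_ :&: _|; set C := #|~: _|.
case E: (n - m) => [|k] eC eJ ltm; first by case: eqP => //; lia.
case: eqP => [eM|nM]; last by rewrite bin_small //; lia.
by rewrite (_ : C = k) ?binn //; lia.
Qed.

Lemma lower_star_degree m (v : johnson n m) : block_degree (@lower_star m) v = m.
Proof.
have := lower_star_meet v v; rewrite setIid (eqP (valP v)) => E.
rewrite -[RHS](_ : (if m is k.+1 then 'C(m, k) else 0) = m); last first.
  by case: (m) => // k; rewrite binSn.
by rewrite -E; apply: eq_card => C; rewrite !inE andbb.
Qed.

Lemma upper_star_degree m (v : johnson n m) : block_degree (@upper_star m) v = n - m.
Proof.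
have := upper_star_meet v v; rewrite setUid.
have -> : #|~: val v| = n - m.
  by have := cardsC (val v); rewrite card_ord (eqP (valP v)); lia.
move=> E; rewrite -[RHS](_ : (if n - m is k.+1 then 'C(n - m, k) else 0) = n - m).
  by rewrite -E; apply: eq_card => C; rewrite !inE andbb.
by case: (n - m) => // k; rewrite binSn.
Qed.

(** The hypothesis says that y is orthogonal to all upper stars, so
    0 = (n - k) |y|^2 + E, where E is the adjacency form; the lower stars give
    0 <= k |y|^2 + E.  As k < n - k, this forces |y|^2 = 0. *)
Lemma inclusion_inj k (y : johnson n k -> rat) : k + k < n ->
  (forall A : johnson n k.+1,
     (\sum_(B : johnson n k | val B \subset val A) y B = 0)%R) ->
  forall B, (y B = 0)%R.
Proof.
move=> lt_kn y0.
have U := sum_sqr_decomposition y (@upper_star_decomposition k).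
have D := sum_sqr_decomposition y (@lower_star_decomposition k).
have U0 : (\sum_A (\sum_(v in @upper_star k A) y v) ^+ 2 = 0)%R.
  rewrite big1 // => A _; rewrite [X in (X ^+ 2)%R](_ : _ = 0%R) ?expr0n //.
  by rewrite -[RHS](y0 A); apply: eq_bigl => B; rewrite inE.
have D0 : (0 <= \sum_C (\sum_(v in @lower_star k C) y v) ^+ 2)%R.
  by apply: sumr_ge0 => C _; exact: sqr_ge0.
have N0 : (0 <= \sum_(v : johnson n k) y v ^+ 2)%R.
  by apply: sumr_ge0 => C _; exact: sqr_ge0.
have S0 : (\sum_(v : johnson n k) y v ^+ 2 = 0)%R.
  move: U D0; rewrite U0 D.
  under eq_bigr do rewrite upper_star_degree.
  under [in X in _ -> X]eq_bigr do rewrite lower_star_degree.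
  rewrite -!mulr_sumr.
  have : ((k%:R + 1 : rat) <= (n - k)%:R)%R by rewrite natr1 ler_nat; lia.
  move: (\sum_u _)%R N0 => E; move: (\sum_v _)%R => S; nra.
move=> B; apply/eqP; rewrite -sqrf_eq0; apply/eqP.
by apply: (psumr_eq0P _ S0) => // C _; exact: sqr_ge0.
Qed.

(** Pair the elements a i of v with distinct elements b i outside v, and let
    the i-th neighbour replace a i by b i.  Two such neighbours share only the
    m - 2 elements of v other than a i and a j. *)
Lemma johnson_independent_neighbors m (v : johnson n m) : m + m <= n ->
  exists s : 'I_m -> johnson n m, (forall i, @adj (johnson n m) v (s i)) /\
    forall i j, i != j -> s i != s j /\ ~~ @adj (johnson n m) (s i) (s j).
Proof.
move=> le_mn; have cv : #|val v| = m := eqP (valP v).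
have cCv : m <= #|~: val v|.
  by have := cardsC (val v); rewrite card_ord cv; lia.
pose a (i : 'I_m) := enum_val (cast_ord (esym cv) i).
pose b (i : 'I_m) := enum_val (widen_ord cCv i).
have av i : a i \in val v := enum_valP _.
have bv i : b i \notin val v by have := enum_valP (widen_ord cCv i); rewrite inE.
have inj_a : injective a by move=> i j /enum_val_inj/cast_ord_inj.
have inj_b : injective b.
  by move=> i j /enum_val_inj/(congr1 val)/= E; apply: val_inj.
pose w i := b i |: (val v :\ a i).
have wP i : #|w i| == m.
  have := cardsD1 (a i) (val v); rewrite av cv cardsU1 !inE (negbTE (bv i)) andbF.
  by move=> def_m; apply/eqP; rewrite [RHS]def_m.
exists (fun i => exist _ (w i) (wP i)); split=> [i|i j ij].
  rewrite /= /johnson_adj -val_eqE /=; apply/andP; split.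
    by apply: contraNneq (bv i) => def_v; rewrite (def_v : val v = w i) setU11.
  have -> : val v :&: w i = val v :\ a i.
    apply/setP => z; rewrite !inE; case: eqP => [->|_] /=.
      by rewrite (negbTE (bv i)) andbF.
    by case: (z \in val v); rewrite ?andbF.
  have := cardsD1 (a i) (val v); rewrite av cv => def_m.
  by apply/eqP; rewrite [X in _ = X - 1]def_m addKn.
have bij : b i != b j by rewrite (inj_eq inj_b).
have aij : a j != a i by rewrite (inj_eq inj_a) eq_sym.
split.
  rewrite -val_eqE /=; apply: contraNneq bij => E.
  have : b i \in w j by rewrite -E setU11.
  by rewrite !inE (negbTE (bv i)) andbF orbF.
rewrite /= /johnson_adj negb_and; apply/orP; right => /=.
have sub : w i :&: w j \subset val v :\ a i :\ a j.
  apply/subsetP => z; rewrite !inE.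
  case/andP => /orP[/eqP->|/andP[-> zv]].
    by rewrite (negbTE bij) (negbTE (bv i)) andbF.
  by case/orP => [/eqP E|/andP[-> _]]; rewrite ?zv // E (negbTE (bv j)) in zv.
have := subset_leq_card sub.
have := cardsD1 (a i) (val v); have := cardsD1 (a j) (val v :\ a i).
by rewrite !inE aij !av cv /=; lia.
Qed.

Lemma cp_johnson k : k.+1 + k.+1 <= n -> cp (johnson n k.+1) = 'C(n, k).
Proof.
move=> le_kn.
have <- : #|{: {C : {set 'I_n} | #|C|.+1 == k.+1}}| = 'C(n, k).
  rewrite card_sig -[n in RHS]card_ord -card_draws.
  by apply: eq_card => A; rewrite !inE.
apply: (@cp_regular_decomposition _ _ (@lower_star k.+1) k.+1).
- exact: lower_star_decomposition.
- exact: lower_star_degree.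
- by move=> v; exact: johnson_independent_neighbors.
(* The condition #|C|.+1 == k.+1 on the indices of the lower stars is
   convertible to #|C| == k, so y is a function on the nodes of johnson n k. *)
move=> y y0; apply: inclusion_inj => [|A]; first by lia.
by rewrite -[RHS](y0 A); apply: eq_bigl => B; rewrite inE.
Qed.

Lemma cp_johnson_le_compl m : m <= n -> cp (johnson n m) <= cp (johnson n (n - m)).
Proof.
move=> le_mn.
have cardC (v : johnson n m) : #|~: val v| == n - m.
  by have := cardsC (val v); rewrite card_ord (eqP (valP v)) => *; apply/eqP; lia.
pose f (v : johnson n m) : johnson n (n - m) := exist _ (~: val v) (cardC v).
have inj_f : injective f by move=> u v [/(inv_inj (@setCK _))/val_inj].
apply: (cp_induced inj_f) => u v.
have [->|uv] := eqVneq u v; first by rewrite !adj_irrefl.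
rewrite !johnson_adjE ?(inj_eq inj_f) //.
rewrite [_ :&: _ in LHS](_ : _ = ~: (val u :|: val v)); last by rewrite setCU.
have := johnson_card_meet uv; have := johnson_card_join u v.
have := cardsC (val u :|: val v); rewrite card_ord.
set J := #|_ :|: _|; set M := #|_ :&: _|; set C := #|~: _| => *.
by apply/eqP/eqP; lia.
Qed.

(** There is only one node, so the empty family of blocks suffices. *)
Lemma cp_johnson_full : cp (johnson n n) = 0.
Proof.
apply/eqP; rewrite -leqn0 -card_void.
apply: (@cp_le_decomposition _ _ (fun=> set0)) => u v /johnson_card_meet.
have full (w : johnson n n) : val w = setT.
  by apply/eqP; rewrite eqEcard subsetT cardsT card_ord (eqP (valP w)) /=.
by rewrite !full setIT cardsT card_ord ltnn.
Qed.

End Johnson.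

Theorem corollary4p5 (n m : nat) (hm : 1 <= m) (hmn : m <= n) :
  cp (johnson n m) = if n < 2 * m then 'C(n, m + 1) else 'C(n, m - 1).
Proof.
case: ltnP => [lt_n|le_n].
  have [->|ne_mn] := eqVneq m n.
    by rewrite cp_johnson_full bin_small // addn1.
  have cpC : cp (johnson n m) = cp (johnson n (n - m)).
    apply/eqP; rewrite eqn_leq cp_johnson_le_compl //=.
    by rewrite -{2}(subKn hmn) cp_johnson_le_compl ?leq_subr.
  have e : n - m = (n - (m + 1)).+1 by lia.
  by rewrite cpC e cp_johnson ?bin_sub //; lia.
by case: m hm hmn le_n => // k _ _ le_n; rewrite cp_johnson ?subn1 //; lia.
Qed.
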